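(* Let $\Sigma: x^+=Ax+Bu$ be a discrete-time linear system without disturbances (i.e. $W=\{0\}$), with $A$ nilpotent of nilpotency index $\nu$, and let the safe set $S_{xu}\subset\mathbb{R}^n\times\mathbb{R}^m$ be a polytope. Let $\mathcal{C}_{\max}$ be the Maximal controlled invariant set of $\Sigma$ within $S_{xu}$. Then $\mathcal{C}_{outer,\nu}=\mathcal{C}_{\max}$ and, thus, there exist $q\in\mathbb{N}$ and matrices $P\in\mathbb{R}^{mq\times mq}$, $H\in\mathbb{R}^{m\times mq}$ such that the corresponding implicit controlled invariant set $\mathcal{C}_{xv}$ is nonempty if and only if $\mathcal{C}_{\max}$ is nonempty.
   Context: Setting: $x\in\mathbb{R}^n$, $u\in\mathbb{R}^m$; $A\in\mathbb{R}^{n\times n}$, $B\in\mathbb{R}^{n\times m}$. $\nu$ is the smallest positive integer with $A^\nu=0$. A polytope is a bounded set of the form $\{z\mid Gz\le f\}$. A controlled invariant set (CIS) of $\Sigma$ within $S_{xu}$ is a set $\mathcal{C}\subseteq\mathbb{R}^n$ such that for every $x\in\mathcal{C}$ there is $u\in\mathbb{R}^m$ with $(x,u)\in S_{xu}$ and $Ax+Bu\in\mathcal{C}$. The Maximal CIS $\mathcal{C}_{\max}$ is the largest such set. In the absence of disturbances, the reachable state is $\mathcal{R}_\Sigma(x,\{u_i\}_{i=0}^{t-1})=A^tx+\sum_{i=1}^tA^{i-1}Bu_{t-i}$, and $$\mathcal{C}_{outer,\nu}=\Big\{x\in\mathbb{R}^n\ \Big|\ \exists\{u_i\}_{i=0}^{\nu-1}\in\mathbb{R}^{m\nu}:\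 (\mathcal{R}_\Sigma(x,\{u_i\}_{i=0}^{t-1}),u_t)\in S_{xu},\ t=0,\dots,\nu-1,\ \ \mathcal{R}_\Sigma(x,\{u_i\}_{i=0}^{\nu-1})\in\mathcal{C}_{\max}\Big\}.$$ The implicit controlled invariant set corresponding to $P,H$ is the maximal set $\mathcal{C}_{xv}\subseteq S_{xv}=\{(x,v)\in\mathbb{R}^n\times\mathbb{R}^{mq}\mid(x,Hv)\in S_{xu}\}$ that is positively invariant for the companion system $x^+=Ax+BHv$, $v^+=Pv$ (i.e. $(x,v)\in\mathcal{C}_{xv}$ implies $(Ax+BHv,Pv)\in\mathcal{C}_{xv}$). Its projection onto the first $n$ coordinates is a controlled invariant set of $\Sigma$ within $S_{xu}$. *)

(* Defs.v *)
From HB Require Import structures.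
From mathcomp Require Import all_boot all_order all_algebra.
From mathcomp Require Import boolp classical_sets reals topology normedtype.

Set Implicit Arguments.
Unset Strict Implicit.
Unset Printing Implicit Defensive.

Import Order.TTheory GRing.Theory Num.Theory numFieldNormedType.Exports.

Local Open Scope classical_set_scope.
Local Open Scope ring_scope.

(* A point (x, u) of R^n x R^m is the stacked column [col_mx x u]; accordingly
   subsets of R^n x R^m have type [set 'cV_(n + m)]. *)

Definition polytope (R : realType) (N : nat) (S : set 'cV[R]_N) : Prop :=
  (exists (k : nat) (G : 'M[R]_(k, N)) (f : 'cV[R]_k),
     S = [set z | forall i : 'I_k, (G *m z) i 0 <= f i 0]) /\
  bounded_set S.

Definition nilpotency_index (R : realType) (n : nat) (A : 'M[R]_n) (nu : nat) :
    Prop :=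
  [/\ (0 < nu)%N, A ^+ nu = 0 &
      forall k : nat, (0 < k)%N -> A ^+ k = 0 -> (nu <= k)%N].

Section Largest.
Variables (T : Type) (F : set (set T)).

(* For an arbitrary family this need not be a member of it; see
   [max_cis_largest] and [implicit_cis_largest] for the families used below. *)
Definition largest : set T := \bigcup_(C in F) C.

Definition is_largest (C : set T) : Prop :=
  F C /\ forall D : set T, F D -> D `<=` C.

Lemma is_largestE (C : set T) : is_largest C -> C = largest.
Proof.
move=> [FC maxC]; apply/seteqP; split=> [x Cx|x [D FD Dx]]; first by exists C.
exact: (maxC D).
Qed.

End Largest.

Section System.
Variables (R : realType) (n m : nat) (A : 'M[R]_n) (B : 'M[R]_(n, m)).
Variable S : set 'cV[R]_(n + m).

Definition controlled_invariant (C : set 'cV[R]_n) : Prop :=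
  forall x, C x ->
    exists u : 'cV[R]_m, S (col_mx x u) /\ C (A *m x + B *m u).

Definition max_cis : set 'cV[R]_n := largest controlled_invariant.

Lemma max_cis_largest : is_largest controlled_invariant max_cis.
Proof.
split=> [x [C CC Cx]|D DD x Dx]; last by exists D.
by have [u [Su Cu]] := CC x Cx; exists u; split=> //; exists C.
Qed.

(* State reached from x under the inputs us`_0, ..., us`_(t-1), t = size us. *)
Definition reach (x : 'cV[R]_n) (us : seq 'cV[R]_m) : 'cV[R]_n :=
  let t := size us in
  A ^+ t *m x + \sum_(1 <= i < t.+1) A ^+ i.-1 *m B *m us`_(t - i).

Definition outer_cis (nu : nat) : set 'cV[R]_n :=
  [set x | exists us : nu.-tuple 'cV[R]_m,
     (forall t : nat, (t < nu)%N -> S (col_mx (reach x (take t us)) us`_t)) /\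
     max_cis (reach x us)].

Section Implicit.
Variables (q : nat) (P : 'M[R]_(m * q)) (H : 'M[R]_(m, m * q)).

Definition safe_xv : set 'cV[R]_(n + m * q) :=
  [set z | S (col_mx (usubmx z) (H *m dsubmx z))].

Definition companion_invariant (C : set 'cV[R]_(n + m * q)) : Prop :=
  forall (x : 'cV[R]_n) (v : 'cV[R]_(m * q)),
    C (col_mx x v) -> C (col_mx (A *m x + B *m H *m v) (P *m v)).

Definition safe_companion_invariant (C : set 'cV[R]_(n + m * q)) : Prop :=
  C `<=` safe_xv /\ companion_invariant C.

Definition implicit_cis : set 'cV[R]_(n + m * q) :=
  largest safe_companion_invariant.

Lemma implicit_cis_largest : is_largest safe_companion_invariant implicit_cis.
Proof.
split=> [|D DD x Dx]; last by exists D.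
split=> [z [C [CS _] Cz]|x v [C [CS CI] Cxv]]; first exact: CS.
by exists C => //; exact: CI.
Qed.

End Implicit.
End System.

(* Main.v *)
Require Import Defs.
From mathcomp Require Import all_boot all_order all_algebra.
From mathcomp Require Import boolp classical_sets reals topology normedtype.
From mathcomp Require Import interval_inference unstable derive convex ring.
Import Order.TTheory GRing.Theory Num.Theory numFieldNormedType.Exports.

Set Implicit Arguments.
Unset Strict Implicit.
Unset Printing Implicit Defensive.

Local Open Scope classical_set_scope.
Local Open Scope ring_scope.

(** Why the theorem is true.

    A state of the maximal controlled invariant set starts a trajectory that
    stays there and is safe for all times; cutting the inputs after [nu] steps
    gives [max_cis `<=` outer_cis].  Conversely, the states met during the
    [nu] safe steps of a point of [outer_cis], added to [max_cis] where these
    steps end, form a controlled invariant set ([outer_cisE]).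

    For the implicit set, a one-block dummy input held constant suffices:
    [q = 1], [P] and [H] identities.  A pair [(x, u)] is then fixed by the
    companion system exactly when [A x + B u = x], so a safe equilibrium gives
    a nonempty implicit set ([equilibrium_implicit_cis]).  A safe equilibrium
    exists as soon as [max_cis] is nonempty ([max_cis_equilibrium]): along an
    infinite safe trajectory the time averages of [(x_k, u_k)] stay in the
    convex set [S], and the equilibrium defect of the average telescopes to
    [(x_N - x_0) / N], which tends to [0]; compactness of [S] turns these
    approximate equilibria into an exact one
    ([convex_compact_coincidence]).  In the other direction, the projection of
    an implicit set on the state space is controlled invariant
    ([usubmx_implicit_cis]). *)

(** * Time averages in a compact convex set *)

Lemma convex_set_average (R : realType) (V : lmodType R) (K : set V)
    (z : nat -> V) (N : nat) :
  convex_set K -> (forall k, K (z k)) ->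
  K (N.+1%:R^-1 *: \sum_(k < N.+1) z k).
Proof.
move=> cK zK; elim: N => [|N IH]; first by rewrite big_ord1 invr1 scale1r.
rewrite big_ord_recr /=; set s := \sum_(_ < _) _ in IH *.
have l0 : 0 <= N.+2%:R^-1 :> R by rewrite invr_ge0.
have l1 : N.+2%:R^-1 <= 1 :> R by rewrite invf_le1 ?ler1n.
(* The new average puts weight 1 / (N + 2) on the new point and the remaining
   weight on the previous average. *)
have /(_ _ _ (Itv01 l0 l1) (mem_set (zK N.+1)) (mem_set IH)) := cK.
move=> /set_mem; rewrite /conv /= /unstable.onem; congr K.
rewrite scalerA scalerDr addrC; congr (_ *: _ + _).
rewrite -natr1; field.
by rewrite nat1r natr1 !pnatr_eq0.
Qed.

(** For [E] the identity and [z] an orbit of [D] this is the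
    Markov-Kakutani argument for a fixed point of [D] in [K].  Two maps are
    needed because the input component of a trajectory is not determined by
    the previous state: [D] computes the next state from a state-input pair
    and [E] reads the state off the next pair.  The averages of [z] satisfy
    [D w = E w] up to a telescoping sum of size [O(1/N)], so the minimum over
    [K] of the continuous function [`|D x - E x|] is [0]. *)
Lemma convex_compact_coincidence (R : realType) (V W : normedModType R)
    (K : set V) (D E : {linear V -> W}) (z : nat -> V) :
  compact K -> convex_set K -> continuous D -> continuous E ->
  (forall k, K (z k)) -> (forall k, D (z k) = E (z k.+1)) ->
  exists2 c, K c & D c = E c.
Proof.
move=> coK cvK cD cE zK DE.
pose f x := `|D x - E x|.
have cf : continuous f.
  by move=> x; apply: cvg_norm; apply: cvgB; [exact: cD|exact: cE].
have [|c /set_mem Kc cmin] :=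
    compact_EVT_min _ coK (continuous_subspaceT cf); first by exists (z 0).
exists c => //; apply/eqP; rewrite -subr_eq0 -normr_eq0 eq_le normr_ge0 andbT.
have /compact_bounded[M [_ Mb]] : compact (E @` K).
  by apply: continuous_compact => //; exact: continuous_subspaceT.
have {}Mb k : `|E (z k)| <= `|M| + 1.
  by apply: (Mb (`|M| + 1)); [rewrite ltr_pwDr ?ler_norm|exists (z k)].
have avg N : `|D c - E c| * N.+1%:R <= (`|M| + 1) + (`|M| + 1).
  have := cmin _ (mem_set (@convex_set_average _ _ _ z N cvK zK)).
  rewrite /f !linearZ /= -scalerDr [D (\sum_(_ < _) _)]linear_sum [E (\sum_(_ < _) _)]linear_sum -sumrB.
  under eq_bigr do rewrite DE.
  rewrite -(big_mkord xpredT (fun k => E (z k.+1) - E (z k))) telescope_sumr //.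
  rewrite normrZ gtr0_norm ?invr_gt0 // mulrC -ler_pdivlMr // => /le_trans; apply.
  by rewrite ler_pM2r ?invr_gt0 // (le_trans (ler_normB _ _)) // lerD.
set e := `|D c - E c| in avg *; rewrite leNgt; apply/negP => e0.
set B := _ + _ in avg.
have B0 : 0 <= B / e by rewrite divr_ge0 ?ltW // ltr_pwDl // addr_ge0.
have := avg (Num.bound (B / e)); apply/negP; rewrite -ltNge mulrC.
by rewrite -ltr_pdivrMr // (lt_trans (archi_boundP B0)) // ltr_nat.
Qed.

(** * Polytopes are compact and convex *)

Section Polytope.
Variables (R : realType).

Lemma continuous_mulmx (p N : nat) (G : 'M[R]_(p, N)) :
  continuous (mulmx G : 'cV[R]_N -> 'cV[R]_p).
Proof.
have -> : mulmx G = fun z : 'cV[R]_N => \sum_j z j 0 *: col j G.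
  apply/funext => z; apply/colP => i; rewrite summxE mxE.
  by apply: eq_bigr => j _; rewrite !mxE mulrC.
move=> z.
apply: (@cvg_big 'cV[R]_p 'I_N +%R 0 xpredT add_continuous _ (nbhs z) _
          (fun j y => y j 0 *: col j G) (fun j => z j 0 *: col j G)) => j _.
by apply: cvgZr_tmp; exact: coord_continuous.
Qed.

Lemma continuous_trmx (p q : nat) : continuous (@trmx R p q).
Proof.
move=> x A /nbhs_ballP[e /= e0 eA].
apply/nbhs_ballP; exists e => //= y [_ xy]; apply: eA; split => // i j.
by rewrite !mxE; exact: xy.
Qed.

(** Transposition carries the Heine-Borel property over from row vectors. *)
Lemma bounded_closed_compact_cV (N : nat) (K : set 'cV[R]_N) :
  bounded_set K -> closed K -> compact K.
Proof.
move=> [M [Mr MK]] clK.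
have -> : K = trmx @` (trmx @^-1` K : set 'rV[R]_N).
  apply/seteqP; split=> [z Kz|_ [z Kz <-] //].
  by exists z^T; rewrite /= trmxK.
apply: continuous_compact; first by apply: continuous_subspaceT; exact: continuous_trmx.
apply: bounded_closed_compact; last by apply: preimage_closed => // z _; exact: continuous_trmx.
exists M; split=> // r /MK Kr z Kz; apply: le_trans (Kr _ Kz).
rewrite [leLHS]/Num.norm [leRHS]/Num.norm /= !mx_normrE.
apply/bigmax_leP; split=> [|[i j] _ /=]; first exact: bigmax_ge_id.
by apply: le_trans (le_bigmax _ _ (j, i)); rewrite mxE.
Qed.

Lemma polytope_compact (N : nat) (S : set 'cV[R]_N) : polytope S -> compact S.
Proof.
move=> [[k [G [f SE]]] bS]; apply: bounded_closed_compact_cV => //.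
rewrite SE.
have -> : [set z | forall i, (G *m z) i 0 <= f i 0] =
    \bigcap_(i in setT) ((fun z : 'cV[R]_N => (G *m z) i 0) @^-1` [set y | y <= f i 0]).
  by apply/seteqP; split=> z Sz i => [_|]; [exact: Sz|exact: (Sz i I)].
apply: closed_bigI => i _; apply: preimage_closed; last exact: closed_le.
move=> z _; apply: (@cvg_comp _ _ _ (mulmx G) (fun y : 'cV_k => y i 0)).
  exact: continuous_mulmx.
exact: coord_continuous.
Qed.

Lemma polytope_convex (N : nat) (S : set 'cV[R]_N) : polytope S -> convex_set S.
Proof.
move=> [[k [G [f ->]]] _] x y l /set_mem Sx /set_mem Sy; apply/mem_set => i /=.
rewrite /conv /= mulmxDr -!scalemxAr !mxE.
have -> : f i 0 = l%:num * f i 0 + (1 - l%:num) * f i 0 by ring.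
apply: lerD; rewrite ler_wpM2l //; first by have := Sx i; rewrite mxE.
by rewrite subr_ge0.
by have := Sy i; rewrite mxE.
Qed.

End Polytope.

(** * Reachable states and safe trajectories *)

Section System.
Variables (R : realType) (n m : nat) (A : 'M[R]_n) (B : 'M[R]_(n, m)).
Variable S : set 'cV[R]_(n + m).

Lemma reach_nil (x : 'cV[R]_n) : reach A B x [::] = x.
Proof. by rewrite /reach /= big_geq // addr0 expr0 mul1mx. Qed.

Lemma reach_rcons (x : 'cV[R]_n) (us : seq 'cV[R]_m) (u : 'cV[R]_m) :
  reach A B x (rcons us u) = A *m reach A B x us + B *m u.
Proof.
rewrite /reach size_rcons; set t := size us.
rewrite big_nat_recl // expr0 mul1mx subSS subn0 nth_rcons ltnn eqxx.
rewrite mulmxDr mulmx_sumr addrCA addrC; congr (_ + _ + _).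
  by rewrite exprS mulmxA.
rewrite !big_nat; apply: eq_bigr => i /andP[i0 it].
rewrite subSS nth_rcons ltn_subrL i0 (leq_trans i0 it) /=.
by rewrite !mulmxA -[A *m A ^+ _]exprS prednK.
Qed.

Lemma reach_mkseq (x : nat -> 'cV[R]_n) (u : nat -> 'cV[R]_m) (t : nat) :
  (forall k, x k.+1 = A *m x k + B *m u k) ->
  reach A B (x 0) (mkseq u t) = x t.
Proof.
move=> xS; elim: t => [|t IH]; first exact: reach_nil.
by rewrite mkseqS reach_rcons IH -xS.
Qed.

(** Choosing an admissible input in each state is a feedback law, whose closed
    loop never leaves [max_cis]. *)
Lemma max_cis_trajectory (x0 : 'cV[R]_n) : max_cis A B S x0 ->
  exists (x : nat -> 'cV[R]_n) (u : nat -> 'cV[R]_m),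
    [/\ x 0 = x0, forall k, x k.+1 = A *m x k + B *m u k,
        forall k, S (col_mx (x k) (u k)) & forall k, max_cis A B S (x k)].
Proof.
move=> mx0; have [mI _] := max_cis_largest A B S.
have /choice[kappa kP] : forall x, exists u, max_cis A B S x ->
    S (col_mx x u) /\ max_cis A B S (A *m x + B *m u).
  move=> x; have [/mI[u uP]|nx] := pselect (max_cis A B S x); first by exists u.
  by exists 0.
pose x k := iter k (fun y => A *m y + B *m kappa y) x0.
have mx k : max_cis A B S (x k) by elim: k => [//|k /kP[]].
by exists x, (kappa \o x); split=> // k; have [] := kP _ (mx k).
Qed.

(** * Outer approximation and implicit set *)

Lemma outer_cisE (nu : nat) : outer_cis A B S nu = max_cis A B S.
Proof.
apply/seteqP; split=> [x [us [safe fin]]|x0 /max_cis_trajectory].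
  (* The safe steps of x, completed by the set where they end, are controlled
     invariant. *)
  exists [set y | max_cis A B S y \/
                  exists2 t, (t < nu)%N & y = reach A B x (take t us)].
    move=> y /= [my|[t tnu ->]].
      have [mI _] := max_cis_largest A B S.
      by have [u [Su mu]] := mI _ my; exists u; split=> //; left.
    exists us`_t; split; first exact: safe.
    rewrite -reach_rcons -take_nth ?size_tuple //.
    have [tnu1|] := ltnP t.+1 nu; first by right; exists t.+1.
    by move=> le; left; rewrite take_oversize ?size_tuple.
  (* Without any step, x itself is the end point. *)
  case: (posnP nu) => [nu0|nu0]; last by right; exists 0%N; rewrite ?take0 ?reach_nil.
  by left; move: fin; rewrite (size0nil (s := us)) ?size_tuple // reach_nil.
move=> [x [u [<- xS Sxu mx]]].
have sz : size (mkseq u nu) == nu by rewrite size_mkseq.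
exists (Tuple sz); split=> [t tnu /=|]; last by rewrite /= reach_mkseq.
rewrite -map_take take_iota (minn_idPl (ltnW tnu)).
by rewrite -/(mkseq u t) reach_mkseq // nth_mkseq.
Qed.

(** The input [H v] is admissible at [x] whenever [(x, v)] lies in the implicit
    set, so the projection of that set is controlled invariant. *)
Lemma usubmx_implicit_cis (q : nat) (P : 'M[R]_(m * q)) (H : 'M[R]_(m, m * q))
    (z0 : 'cV[R]_(n + m * q)) :
  implicit_cis A B S P H z0 -> max_cis A B S (usubmx z0).
Proof.
move=> Cz0; exists (usubmx @` implicit_cis A B S P H); last by exists z0.
move=> _ [z Cz <-].
have [[safe inv] _] := implicit_cis_largest A B S P H.
exists (H *m dsubmx z); split; first exact: safe.
exists (col_mx (A *m usubmx z + B *m H *m dsubmx z) (P *m dsubmx z)).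
  by apply: inv; rewrite vsubmxK.
by rewrite col_mxKu mulmxA.
Qed.

(** With [P] the identity, the singleton [(x, v)] is invariant under the
    companion system. *)
Lemma equilibrium_implicit_cis (x : 'cV[R]_n) (u : 'cV[R]_m)
    (q : nat) (H : 'M[R]_(m, m * q)) (v : 'cV[R]_(m * q)) :
  S (col_mx x u) -> A *m x + B *m u = x -> H *m v = u ->
  implicit_cis A B S 1%:M H (col_mx x v).
Proof.
move=> Sxu fixx Hv; exists [set col_mx x v] => //; split=> [_ ->|y w /eq_col_mx[-> ->]].
  by rewrite /safe_xv /= col_mxKu col_mxKd Hv.
by rewrite -mulmxA Hv fixx mul1mx.
Qed.

Lemma max_cis_equilibrium : compact S -> convex_set S ->
  max_cis A B S !=set0 -> exists x u, S (col_mx x u) /\ A *m x + B *m u = x.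
Proof.
move=> coS cvS [x0 /max_cis_trajectory[x [u [_ xS Sxu _]]]].
have [|||c Sc] := @convex_compact_coincidence R _ _ S
  (mulmx (row_mx A B)) (mulmx (row_mx 1%:M 0))
  (fun k => col_mx (x k) (u k)) coS cvS _ _ Sxu.
- exact: continuous_mulmx.
- exact: continuous_mulmx.
- by move=> k /=; rewrite !mul_row_col mul1mx mul0mx addr0 xS.
rewrite /= -[c]vsubmxK !mul_row_col mul1mx mul0mx addr0 => fixc.
by exists (usubmx c), (dsubmx c); rewrite vsubmxK.
Qed.

End System.

Theorem corollary6p5 (R : realType) (n m : nat)
    (A : 'M[R]_n) (B : 'M[R]_(n, m)) (nu : nat) (Sxu : set 'cV[R]_(n + m)) :
  nilpotency_index A nu ->
  polytope Sxu ->
  outer_cis A B Sxu nu = max_cis A B Sxu /\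
  exists (q : nat) (P : 'M[R]_(m * q)) (H : 'M[R]_(m, m * q)),
    (0 < q)%N /\
    (implicit_cis A B Sxu P H !=set0 <-> max_cis A B Sxu !=set0).
Proof.
move=> _ pS; split; first exact: outer_cisE.
(* H is the identity; H and u have to be cast along m = m * 1. *)
pose e := esym (muln1 m).
exists 1%N, 1%:M, (castmx (erefl m, e) 1%:M); split=> //; split=> [[z Cz]|].
  by exists (usubmx z); apply: usubmx_implicit_cis Cz.
move=> /(max_cis_equilibrium (polytope_compact pS) (polytope_convex pS)).
move=> [x [u [Sxu_xu fixx]]].
exists (col_mx x (castmx (e, erefl 1%N) u)).
apply: equilibrium_implicit_cis Sxu_xu fixx _.
by case: _ / e; rewrite !castmx_id mul1mx.
Qed.
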